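(* Let $x_1,x_2,y_1,y_2,u_1,u_2,v_2,\lambda$ and $\mathbf{w}=(w_\ell)_{\ell\ge 0}$ be commuting indeterminates. For $n\ge 0$ let \[ \widehat{Q}_n(x_1,x_2,y_1,y_2,u_1,u_2,v_1,v_2,\mathbf{w},\lambda)=\sum_{\sigma\in\mathfrak{S}_n} x_1^{\mathrm{eareccpeak}(\sigma)}x_2^{\mathrm{eareccdfall}(\sigma)}y_1^{\mathrm{ereccval}(\sigma)}y_2^{\mathrm{ereccdrise}(\sigma)}u_1^{\mathrm{nrcpeak}(\sigma)}u_2^{\mathrm{nrcdfall}(\sigma)}v_1^{\mathrm{nrcval}(\sigma)}v_2^{\mathrm{nrcdrise}(\sigma)}\Big(\prod_{i\in\mathrm{Fix}(\sigma)}w_{\mathrm{psnest}(i,\sigma)}\Big)\lambda^{\mathrm{cyc}(\sigma)} . \] Then, as formal power series in $t$, \[ \sum_{n\ge0}\widehat{Q}_n(x_1,x_2,y_1,y_2,u_1,u_2,y_1,v_2,\mathbf{w},\lambda)\,t^n =\cfrac{1}{1-\gamma_0t-\cfrac{\beta_1t^2}{1-\gamma_1t-\cfrac{\beta_2t^2}{1-\gamma_2 t-\cdots}}} \] (i.e. with $v_1$ specialised to $y_1$), where $\gamma_0=\lambda w_0$, $\gamma_n=[x_2+(n-1)u_2]+[y_2+(n-1)v_2]+\lambda w_n$ for $n\ge1$, and $\beta_n=(\lambda+n-1)[x_1+(n-1)u_1]\,y_1$ for $n\ge1$.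
   Context: $\mathfrak{S}_n$ is the set of permutations of $[n]=\{1,\dots,n\}$. For $\sigma\in\mathfrak{S}_n$, an index $i$ is a cycle peak if $\sigma^{-1}(i)<i>\sigma(i)$, a cycle valley if $\sigma^{-1}(i)>i<\sigma(i)$, a cycle double rise if $\sigma^{-1}(i)<i<\sigma(i)$, a cycle double fall if $\sigma^{-1}(i)>i>\sigma(i)$, a fixed point if $\sigma(i)=i$; $\mathrm{Fix}(\sigma)$ is the set of fixed points. An index $i$ is a record if $\sigma(j)<\sigma(i)$ for all $j<i$, and an antirecord if $\sigma(j)>\sigma(i)$ for all $j>i$; it is an exclusive record if it is a record but not an antirecord, an exclusive antirecord if it is an antirecord but not a record, and ''nr'' if it is neither a record nor an antirecord. Then $\mathrm{eareccpeak}(\sigma)$ (resp. $\mathrm{eareccdfall}(\sigma)$) is the number of cycle peaks (resp. cycle double falls) that are exclusive antirecords; $\mathrm{ereccval}(\sigma)$ (resp. $\mathrm{ereccdrise}(\sigma)$) is the number of cycle valleys (resp. cycle double rises) that are exclusive records; $\mathrm{nrcpeak},\mathrm{nrcdfall},\mathrm{nrcval},\mathrm{nrcdrise}$ count cycle peaks, cycle double falls, cycle valleys, cycle double rises that are neither records nor antirecords. For a fixed point $i$, $\mathrm{psnest}(i,\sigma)=\#\{j<i:\sigma(j)>i\}$. $\mathrm{cyc}(\sigma)$ is the number of cycles of $\sigma$ (fixed points count as cycles). *)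

(* Defs.v *)
From HB Require Import structures.
From mathcomp Require Import all_boot all_order all_algebra all_fingroup.

Set Implicit Arguments.
Unset Strict Implicit.
Unset Printing Implicit Defensive.

Import GRing.Theory.

(** The set [n] = {1, ..., n} is represented by ['I_n] = {0, ..., n - 1}; all the
  statistics below only compare indices, so this order-preserving shift is
  harmless. *)

Section Statistics.

Variables (n : nat) (s : 'S_n).
Implicit Types i j : 'I_n.

Definition cpeak i := ((s^-1)%g i < i) && (s i < i).
Definition cval i := (i < (s^-1)%g i) && (i < s i).
Definition cdrise i := ((s^-1)%g i < i) && (i < s i).
Definition cdfall i := (i < (s^-1)%g i) && (s i < i).

Definition record i := [forall j : 'I_n, (j < i) ==> (s j < s i)].
Definition antirecord i := [forall j : 'I_n, (i < j) ==> (s i < s j)].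
Definition erec i := record i && ~~ antirecord i.
Definition earec i := antirecord i && ~~ record i.
Definition nrar i := ~~ record i && ~~ antirecord i.

Definition eareccpeak := #|[set i | cpeak i && earec i]|.
Definition eareccdfall := #|[set i | cdfall i && earec i]|.
Definition ereccval := #|[set i | cval i && erec i]|.
Definition ereccdrise := #|[set i | cdrise i && erec i]|.
Definition nrcpeak := #|[set i | cpeak i && nrar i]|.
Definition nrcdfall := #|[set i | cdfall i && nrar i]|.
Definition nrcval := #|[set i | cval i && nrar i]|.
Definition nrcdrise := #|[set i | cdrise i && nrar i]|.

Definition psnest i := #|[set j : 'I_n | (j < i) && (i < s j)]|.

Definition cyc := #|porbits s|.

End Statistics.

Local Open Scope ring_scope.

Definition Qhat (R : comNzRingType) (x1 x2 y1 y2 u1 u2 v1 v2 : R)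
    (w : nat -> R) (lambda : R) (n : nat) : R :=
  \sum_(s : 'S_n)
    x1 ^+ eareccpeak s * x2 ^+ eareccdfall s *
    y1 ^+ ereccval s * y2 ^+ ereccdrise s *
    u1 ^+ nrcpeak s * u2 ^+ nrcdfall s *
    v1 ^+ nrcval s * v2 ^+ nrcdrise s *
    (\prod_(i : 'I_n | s i == i) w (psnest s i)) * lambda ^+ cyc s.

(** A formal power series [\sum_n f n * t ^ n] is its coefficient sequence. *)

Definition fps (R : Type) := nat -> R.

Section PowerSeries.

Variable R : comNzRingType.
Implicit Types f g : fps R.

Definition fps_mul f g : fps R := fun n => \sum_(i < n.+1) f i * g (n - i)%N.

(** The first [n.+1] coefficients of the inverse of [f], assuming [f 0 = 1]. *)
Fixpoint fps_inv_seq f (n : nat) : seq R :=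
  if n is m.+1 then
    let h := fps_inv_seq f m in
    rcons h (- \sum_(i < m.+1) f i.+1 * h`_(m - i))
  else [:: 1].

(** The inverse [1 / f] of a series with constant term 1 (see [fps_mulV]); it is
    only meant to be used for such series. *)
Definition fps_inv f : fps R := fun n => (fps_inv_seq f n)`_n.

Lemma size_fps_inv_seq f n : size (fps_inv_seq f n) = n.+1.
Proof. by elim: n => //= n IHn; rewrite size_rcons IHn. Qed.

Lemma nth_fps_inv_seq f n k : (k <= n)%N -> (fps_inv_seq f n)`_k = fps_inv f k.
Proof.
elim: n => [|n IHn]; first by rewrite leqn0 => /eqP->.
rewrite leq_eqVlt ltnS => /predU1P[-> //|le_kn].
by rewrite /= nth_rcons size_fps_inv_seq ltnS le_kn IHn.
Qed.

Lemma fps_mulV f : f 0%N = 1 ->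
  forall n, fps_mul f (fps_inv f) n = (n == 0%N)%:R.
Proof.
move=> f0 [|n]; first by rewrite /fps_mul big_ord1 f0 mul1r.
rewrite /fps_mul big_ord_recl f0 mul1r subn0 {1}/fps_inv /=.
rewrite nth_rcons size_fps_inv_seq ltnn eqxx.
rewrite [X in _ + X](_ : _ = \sum_(i < n.+1) f i.+1 * (fps_inv_seq f n)`_(n - i)).
  by rewrite addNr.
by apply: eq_bigr => i _; rewrite subSS nth_fps_inv_seq // leq_subr.
Qed.

(** The series [1 - c * t - b * t ^ 2 * g]. *)
Definition J_denom (c b : R) g : fps R := fun n =>
  match n with
  | 0 => 1
  | 1 => - c
  | m.+2 => - (b * g m)
  end.

(** The finite continued fraction with levels [k, k + 1, ..., k + d], that is
    [1 / (1 - gamma_k t - beta_(k+1) t^2 / (... / (1 - gamma_(k+d) t)))]. *)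
Fixpoint J_convergent (gamma beta : nat -> R) (k d : nat) : fps R :=
  fps_inv
    (if d is d'.+1 then
       J_denom (gamma k) (beta k.+1) (J_convergent gamma beta k.+1 d')
     else J_denom (gamma k) 0 (fun=> 0)).

(** Convergence for the [t]-adic topology: each coefficient is eventually
    constant. *)
Definition fps_cvg (F : nat -> fps R) f :=
  forall n, exists N, forall d, (N <= d)%N -> F d n = f n.

(** [f] is the infinite continued fraction
    [1 / (1 - gamma_0 t - beta_1 t^2 / (1 - gamma_1 t - beta_2 t^2 / ...))]. *)
Definition is_J_fraction f (gamma beta : nat -> R) :=
  fps_cvg (J_convergent gamma beta 0) f.

End PowerSeries.

(* Main.v *)
(** The type word of a permutation records which of the five types each index
    has; it is a Motzkin word whose height before [i] is the number of [j < i]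
    with [s j >= i].  Fix such a word and build the permutations having it:
    first choose [s i] for the positions with [s i < i], in increasing order,
    then for those with [s i > i], in decreasing order.

    In the first phase [i] picks one of the [k] unused admissible values, [k]
    being the height before [i], and [i] is an antirecord exactly when it picks
    the smallest.  In the second phase the number of available values is the
    height after [i], and [i] is a record exactly when it picks the largest.  A
    cycle that is not a fixed point is closed when its minimum, a cycle valley,
    is treated; for each cycle valley [i] exactly one available value closes a
    cycle, namely the start of the path ending at [i].  This is where
    [v1 = y1] is needed: the choice of a cycle valley can then be used to
    count cycles since it does not have to count records.

    Hence the sum over a type class is a product of step weights depending on
    the heights only, and the continued fraction follows from the decomposition
    of Motzkin paths at the first passage to a lower height. *)

Require Import Defs.
From mathcomp Require Import all_boot all_order all_algebra all_fingroup.
From mathcomp Require Import zify ring.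

Set Implicit Arguments.
Unset Strict Implicit.
Unset Printing Implicit Defensive.

Import GRing.Theory.

Local Open Scope ring_scope.

(** * Motzkin paths and J-fractions *)

Section MotzkinPaths.

Variables (R : comNzRingType) (up level down : nat -> R).

(** Weighted count of the Motzkin paths with [n] steps from height [k] to
    height [j] that stay weakly above [j]. *)
Fixpoint motzkin (j n k : nat) : R :=
  if n is m.+1 then
    up k * motzkin j m k.+1 + level k * motzkin j m k
      + (if (k <= j)%N then 0 else down k * motzkin j m k.-1)
  else (k == j)%:R.

(** Cut the path at its first step from [j.+1] to [j], taken after [i] steps: what precedes stays
    weakly above [j.+1], what follows starts afresh at [j]. *)
Lemma motzkin_first_passage j n k : (j < k)%N ->
  motzkin j n k =
  \sum_(i < n) motzkin j.+1 i k * down j.+1 * motzkin j (n - i.+1) j.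
Proof.
elim: n k => [|n IHn] k lt_jk.
  by rewrite big_ord0 /= gtn_eqF.
rewrite big_ord_recl /= subn1 /= (IHn k) // (IHn k.+1 (ltnW lt_jk)) (leqNgt k) lt_jk /=.
(* When [k = j.+1], an initial down step is already the first passage and gives the term [i = 0]. *)
have [le_kj|lt_jk1] := leqP k j.+1.
  have -> : k = j.+1 by apply/eqP; rewrite eqn_leq le_kj lt_jk.
  rewrite eqxx mul1r addrC; congr (_ + _).
  rewrite !mulr_sumr -big_split /=; apply: eq_bigr => i _.
  by rewrite subSS; ring.
rewrite gtn_eqF // mul0r mul0r add0r (IHn k.-1); last by lia.
rewrite !mulr_sumr -!big_split /=; apply: eq_bigr => i _.
by rewrite subSS; ring.
Qed.

Lemma motzkin_excursionS j n :
  motzkin j n.+1 j = level j * motzkin j n j + up j * down j.+1 *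
    \sum_(i < n) motzkin j.+1 i j.+1 * motzkin j (n - i.+1) j.
Proof.
rewrite /= leqnn addr0 addrC (motzkin_first_passage _ (ltnSn j)); congr (_ + _).
by rewrite !mulr_sumr; apply: eq_bigr => i _; ring.
Qed.

(** This extracts a coefficient from [f * (1 / f) = 1]; the recurrence has the shape of
    [motzkin_excursionS]. *)
Lemma fps_inv_J_denomS (c b : R) g n :
  fps_inv (J_denom c b g) n.+1 = c * fps_inv (J_denom c b g) n +
    b * \sum_(i < n) g i * fps_inv (J_denom c b g) (n - i.+1)%N.
Proof.
have := fps_mulV (f := J_denom c b g) erefl n.+1.
rewrite /fps_mul big_ord_recl big_ord_recl /= mul1r mulNr => /eqP.
rewrite addrA addr_eq0 subr_eq => /eqP; rewrite subn0 subn1 /= => ->.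
rewrite addrC; congr (_ + _); rewrite mulr_sumr -sumrN.
by apply: eq_bigr => i _; rewrite /bump /= subSS; ring.
Qed.

(** Both sides obey the same recurrence. Truncating at depth [d] is harmless because an excursion of
    [n <= d] steps never rises above [k + d]. *)
Lemma J_convergent_motzkin (gamma beta : nat -> R) :
    gamma =1 level -> (forall k, beta k.+1 = up k * down k.+1) ->
  forall d k n, (n <= d)%N -> J_convergent gamma beta k d n = motzkin k n k.
Proof.
move=> gammaE betaE; elim=> [|d IHd] k n.
  by rewrite leqn0 => /eqP->; rewrite /= eqxx.
elim/ltn_ind: n => -[|n] IHn le_nd; first by rewrite /= eqxx.
have -> : J_convergent gamma beta k d.+1 n.+1 =
    gamma k * J_convergent gamma beta k d.+1 n + beta k.+1 *
      \sum_(i < n) J_convergent gamma beta k.+1 d i *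
                   J_convergent gamma beta k d.+1 (n - i.+1)%N.
  exact: fps_inv_J_denomS.
rewrite motzkin_excursionS -gammaE -betaE.
congr (_ * _ + _ * _); first by apply: IHn => //; apply: ltnW.
apply: eq_bigr => i _; rewrite IHd ?(leq_trans (ltnW (ltn_ord i))) //.
by congr (_ * _); apply: IHn; rewrite ?ltnS ?leq_subr //; lia.
Qed.

End MotzkinPaths.

(** * Cycle minima *)

Section CycleMinima.

Variables (n : nat) (s : 'S_n).

Definition cycle_min (i : 'I_n) := [forall j in porbit s i, (i <= j)%N].

Lemma card_cycle_min : cyc s = #|[set i | cycle_min i]|.
Proof.
rewrite /cyc -(card_in_imset (f := porbit s)) => [|i j]; last first.
  rewrite !inE => /forall_inP min_i /forall_inP min_j eq_ij; apply/val_inj/eqP.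
  by rewrite eqn_leq min_i ?min_j -?eq_porbit_mem ?eq_ij.
apply: eq_card => A; apply/imsetP/imsetP=> [[i _ ->]|[i _ ->]]; last by exists i.
have [j ij min_j] := arg_minnP (fun j : 'I_n => val j) (porbit_id s i).
have eq_ij : porbit s i = porbit s j.
  by apply/eqP; rewrite eq_porbit_mem porbit_sym.
by exists j; rewrite // inE; apply/forall_inP => k; rewrite -eq_ij => /min_j.
Qed.

(** The return condition makes [t.+1] a period of [s^-1] at [i], so the backward iterates up to [t]
    exhaust the cycle. *)
Lemma cycle_min_return (i : 'I_n) t :
    s i = iter t (s^-1)%g i ->
    (forall r, (r <= t)%N -> (i <= iter r (s^-1)%g i)%N) ->
  cycle_min i.
Proof.
move=> ret_i ge_i; apply/forall_inP => j; rewrite -porbitV => /porbitP[m ->].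
have per : iter t.+1 (s^-1)%g i = i by rewrite iterS -ret_i permK.
rewrite permX; elim/ltn_ind: m => m IHm; have [/ge_i //|lt_tm] := leqP m t.
by rewrite -(subnK lt_tm) iterD per; apply: IHm; lia.
Qed.

End CycleMinima.

(** * Sums over sequences of choices *)

Section SequentialChoice.

Variables (R : comNzRingType) (n : nat) (X : {set 'S_n}) (key : 'I_n -> nat).
Variables (f : 'I_n -> 'S_n -> R) (c : 'I_n -> R).

Definition agree_below (m : nat) (s t : 'S_n) :=
  [forall j, (key j < m)%N ==> (t j == s j)].

(** [V] holds the values left for [i] after the choices of [s] at smaller keys. [V] and [g] may
    depend on those choices but the total [c i] does not, which is why the whole sum factors. *)
Definition choice_at (i : 'I_n) (s : 'S_n) (V : {set 'I_n}) (g : 'I_n -> R) :=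
  [/\ forall t, t \in X -> agree_below (key i) s t ->
        t i \in V /\ f i t = g (t i),
      forall v, v \in V -> exists2 t, t \in X & agree_below (key i) s t /\ t i = v
    & \sum_(v in V) g v = c i].

Hypothesis key_inj : injective key.
Hypothesis choiceP : forall i s, s \in X -> exists V, exists g, choice_at i s V g.

Lemma sum_agree_below d m s : (forall j, key j < m + d)%N -> s \in X ->
  \sum_(t in X | agree_below m s t) \prod_(i | (m <= key i)%N) f i t =
  \prod_(i | (m <= key i)%N) c i.
Proof.
elim: d m s => [|d IHd] m s key_lt sX.
  rewrite [RHS]big_pred0 => [|i]; last by rewrite leqNgt -[m]addn0 key_lt.
  rewrite (big_pred1 s) => [|t].
    by rewrite big_pred0 // => i; rewrite leqNgt -[m]addn0 key_lt.
  apply/andP/eqP=> [[_ /forallP agr]|->]; last first.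
    by split=> //; apply/forallP => j; rewrite eqxx implybT.
  apply/permP => j; move: (agr j); have := key_lt j; rewrite addn0 => ->.
  by move/eqP.
have key_lt' j : (key j < m.+1 + d)%N by rewrite addSnnS.
(* Keys need not be consecutive: if none equals [m], there is nothing to choose. *)
case: (pickP (fun i => key i == m)) => [i /eqP key_i|no_i]; last first.
  have ne j : key j <> m by move/eqP; rewrite [_ == _]no_i.
  have geE j : (m <= key j)%N = (m < key j)%N by have := ne j; lia.
  rewrite (eq_bigl _ _ geE) -(IHd _ s) //; apply: eq_big => t; last first.
    by move=> _; apply: eq_bigl.
  congr (_ && _); apply: eq_forallb => j; congr (_ ==> _).
  by have := ne j; lia.
have geE j : (m <= key j)%N = (j == i) || (m < key j)%N.
  have := inj_eq key_inj j i; rewrite key_i; lia.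
have prodE (F : 'I_n -> R) :
    \prod_(j | (m <= key j)%N) F j = F i * \prod_(j | (m < key j)%N) F j.
  rewrite (bigD1 i) ?key_i ?leqnn //=; congr (_ * _); apply: eq_bigl => j.
  rewrite geE; have [eq_ji|_] := eqVneq j i; last by rewrite andbT.
  by rewrite eq_ji key_i ltnn.
have [V [g [inV extV sumV]]] := choiceP i sX.
rewrite key_i in inV extV.
(* Split according to the value at [i]; for each value, a permutation [t0] taking it is the new
   reference for the induction hypothesis. *)
rewrite (partition_big (fun t : 'S_n => t i) (mem V)) => [|t /andP[tX agr]]; last first.
  by have [] := inV t tX agr.
rewrite prodE -sumV mulr_suml; apply: eq_bigr => v Vv.
have [t0 t0X [agr0 t0v]] := extV v Vv.
rewrite -(IHd _ _ key_lt' t0X) mulr_sumr; apply: eq_big => t.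
  case tX: (t \in X) => //=; apply/andP/forallP => [[/forallP agr /eqP tv] j|agr].
    have [-> | ne_ji] := eqVneq j i; first by rewrite tv t0v eqxx implybT.
    apply/implyP => le_jm; have lt_jm : (key j < m)%N.
      by move: ne_ji; rewrite -(inj_eq key_inj) key_i; lia.
    have := agr j; rewrite lt_jm => /eqP ->.
    by have /forallP/(_ j) := agr0; rewrite lt_jm eq_sym.
  split; last by rewrite -t0v; have := agr i; rewrite key_i leqnn.
  apply/forallP => j; apply/implyP => lt_jm.
  have := agr j; rewrite ltnW // => /eqP ->.
  by have /forallP/(_ j) := agr0; rewrite lt_jm.
case/andP=> /andP[tX agr] /eqP tv; rewrite prodE.
by have [_ ->] := inV t tX agr; rewrite tv.
Qed.

Lemma sequential_choice s : s \in X ->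
  \sum_(t in X) \prod_i f i t = \prod_i c i.
Proof.
move=> sX; have := @sum_agree_below (\max_j (key j).+1) 0 s _ sX.
rewrite add0n => H.
rewrite -[RHS]H => [|j]; last exact: (leq_bigmax (F := fun j => (key j).+1)).
by apply: eq_bigl => t; rewrite andb_idr // => _; apply/forallP.
Qed.

End SequentialChoice.

(** * Type words *)

Section Types.

Variable n : nat.
Implicit Types (s t : 'S_n) (i j v : 'I_n).

(** [None] is the type of a fixed point; for the other indices, the two
    components of [Some (a, b)] tell whether [i < s i] and whether
    [s^-1 i < i], so that cycle valleys, peaks, double rises and double falls
    are encoded by [(true, false)], [(false, true)], [(true, true)] and
    [(false, false)]. *)
Definition step := option (bool * bool).

Definition type_of s i : step :=
  if s i == i then None else Some ((i < s i)%N, ((s^-1)%g i < i)%N).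

Definition height s m := #|[set j : 'I_n | (j < m <= s j)%N]|.

Definition next_height (k : nat) (a : step) : nat :=
  match a with
  | Some (true, false) => k.+1
  | Some (false, true) => k.-1
  | _ => k
  end.

Lemma mem_perm_imset s (A : {set 'I_n}) v : (v \in s @: A) = ((s^-1)%g v \in A).
Proof. by rewrite -{1}[v](permKV s) mem_imset //; apply: perm_inj. Qed.

(** The initial segment [A] and its image have the same size, hence so do their two set
    differences. *)
Lemma card_values_across s m :
  #|[set v : 'I_n | (v < m <= (s^-1)%g v)%N]| = height s m.
Proof.
pose A := [set j : 'I_n | (j < m)%N].
have -> : [set v : 'I_n | (v < m <= (s^-1)%g v)%N] = A :\: (s @: A).
  apply/setP => v; rewrite !inE andbC leqNgt; congr (~~ _ && _).
  by rewrite mem_perm_imset inE.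
have -> : height s m = #|(s @: A) :\: A|.
  rewrite /height -[LHS](card_imset _ (@perm_inj _ s)); apply: eq_card => v.
  by rewrite mem_perm_imset !inE mem_perm_imset inE -leqNgt permKV andbC.
by rewrite !cardsD setIC card_imset //; apply: perm_inj.
Qed.

Lemma card_values_above s i :
  #|[set v : 'I_n | ((s^-1)%g v <= i < v)%N]| = height s i.+1.
Proof.
rewrite /height -[RHS](card_imset _ (@perm_inj _ s)); apply: eq_card => v.
by rewrite -[v](permKV s) mem_imset ?inE ?permK //; apply: perm_inj.
Qed.

Lemma height0 s : height s 0 = 0%N.
Proof. by apply: eq_card0 => j; rewrite inE. Qed.

Lemma heightn s : height s n = 0%N.
Proof.
apply: eq_card0 => j; rewrite inE; apply/negP => /andP[_ le_n].
by have := leq_ltn_trans le_n (ltn_ord _); rewrite ltnn. Qed.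

Lemma card_psnest s i : s i = i -> psnest s i = height s i.
Proof.
move=> fix_i; apply: eq_card => j; rewrite !inE; case: (ltnP j i) => //= lt_ji.
rewrite ltn_neqAle andb_idl // => _; apply: contraTneq lt_ji => eq_ij.
by rewrite -(perm_inj (etrans fix_i (val_inj eq_ij))) ltnn.
Qed.

Lemma heightS s i : height s i.+1 = next_height (height s i) (type_of s i).
Proof.
(* [C] counts the arcs passing strictly over [i]. The height before [i] adds an arc arriving at [i]
   from the left, the height after [i] an arc leaving to the right. *)
pose C := #|[set j : 'I_n | (j < i < s j)%N]|.
have hS : height s i.+1 = ((i < s i) + C)%N.
  rewrite /height (cardsD1 i) inE leqnn /=; congr (_ + _)%N.
  apply: eq_card => j; rewrite !inE -val_eqE /=; lia.
have hE : height s i = (((s^-1)%g i < i) + C)%N.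
  rewrite /height (cardsD1 ((s^-1)%g i)) inE permKV leqnn andbT; congr (_ + _)%N.
  apply: eq_card => j; rewrite !inE -(canF_eq (permK s)) -val_eqE /=; lia.
rewrite hS hE /type_of; case: eqP => [fix_i|ne_i] /=.
  have -> : (s^-1)%g i = i by rewrite -{1}fix_i permK.
  by rewrite fix_i.
by case: (i < s i)%N; case: (_ < i)%N.
Qed.

Lemma type_cases s i :
  match type_of s i with
  | None => s i = i /\ (s^-1)%g i = i
  | Some (a, b) => (if a then i < s i else s i < i)%N /\
                   (if b then (s^-1)%g i < i else i < (s^-1)%g i)%N
  end.
Proof.
rewrite /type_of; case: eqP => [fix_i|ne_i]; first by rewrite -{3}fix_i permK.
by split; case: ltngtP => // /val_inj e; case: ne_i; rewrite -{1}e ?permKV.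
Qed.

Lemma type_ofP s i (a : step) :
  match a with
  | None => s i = i
  | Some (a, b) => (if a then i < s i else s i < i)%N /\
                   (if b then (s^-1)%g i < i else i < (s^-1)%g i)%N
  end -> type_of s i = a.
Proof.
rewrite /type_of; case: a => [[a b] [Ha Hb]|->]; last by rewrite eqxx.
rewrite -val_eqE /=; case: eqP => [e|_]; first by case: a Ha; lia.
by congr (Some (_, _)); [case: a Ha {Hb}; lia|case: b Hb {Ha}; lia].
Qed.

(** Match the two largest elements, remove them and repeat. *)
Lemma ascending_matching (P Q : {set 'I_n}) :
    #|P| = #|Q| ->
    (forall i, #|[set q in Q | (q <= i)%N]| <= #|[set p in P | (p < i)%N]|)%N ->
  exists f, exists g : 'I_n -> 'I_n,
    {in P, forall p : 'I_n, [/\ f p \in Q, (p < f p)%N & g (f p) = p]} /\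
    {in Q, forall q : 'I_n, [/\ g q \in P, (g q < q)%N & f (g q) = q]}.
Proof.
move cP: #|P| => c; elim: c P Q cP => [|c IHc] P Q cP cQ le_QP.
  exists id, id; rewrite (cards0_eq cP) (cards0_eq (esym cQ)).
  by split=> x; rewrite inE.
have [p0 Pp0] : exists p, p \in P by apply/card_gt0P; rewrite cP.
have [q0 Qq0] : exists q, q \in Q by apply/card_gt0P; rewrite -cQ.
have [p /= Pp max_p] := @arg_maxnP _ p0 (mem P) (fun i : 'I_n => val i) Pp0.
have [q /= Qq max_q] := @arg_maxnP _ q0 (mem Q) (fun i : 'I_n => val i) Qq0.
have cP' : #|P :\ p| = c by move: (cardsD1 p P); rewrite Pp cP; lia.
have cQ' : #|Q :\ q| = c by move: (cardsD1 q Q); rewrite Qq -cQ; lia.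
have subP i : [set x in P :\ p | (x < i)%N] = [set x in P | (x < i)%N] :\ p.
  by apply/setP => x; rewrite !inE andbA.
have subQ i : [set x in Q :\ q | (x <= i)%N] = [set x in Q | (x <= i)%N] :\ q.
  by apply/setP => x; rewrite !inE andbA.
(* All of [Q] is at most [q], so the counting hypothesis at [q] puts all of [P] strictly below
   [q]. *)
have lt_pq : (p < q)%N.
  have /eqP eqP : [set x in P | (x < q)%N] == P.
    rewrite eqEcard; apply/andP; split; first by apply/subsetP => x; case/setIdP.
    apply: leq_trans (le_QP q); rewrite cP cQ; apply: subset_leq_card.
    by apply/subsetP => x Qx; rewrite inE Qx; apply: max_q.
  by move: Pp; rewrite -eqP inE => /andP[].
have [|f [g [fP gP]]] := IHc (P :\ p) (Q :\ q) cP' (esym cQ').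
  (* For [i <= p] the removal of [p] does not affect the count in [P]; for [i > p] that count is all
     of [P :\ p]. *)
  move=> i; have [le_ip|lt_pi] := leqP i p.
    rewrite subP subQ; apply: leq_trans (subset_leq_card (subD1set _ _)) _.
    apply: leq_trans (le_QP i) _; apply: subset_leq_card.
    by apply/subsetP => x; rewrite !inE -val_eqE /=; case: (x \in P); lia.
  rewrite [X in (_ <= X)%N](_ : _ = #|P :\ p|).
    by rewrite cP' -cQ' subset_leq_card //; apply/subsetP => x /setIdP[].
  apply: eq_card => x; rewrite !inE; case Px: (x \in P); last by rewrite andbF.
  by have := max_p x Px; case: eqP => //=; lia.
exists (fun x => if x == p then q else f x), (fun x => if x == q then p else g x).
split=> x Xx; have [->|ne_x] := eqVneq; rewrite ?eqxx //.
  have /fP : x \in P :\ p by rewrite !inE ne_x.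
  by rewrite !inE => -[/andP[/negPf-> ->] -> ->].
have /gP : x \in Q :\ q by rewrite !inE ne_x.
by rewrite !inE => -[/andP[/negPf-> ->] -> ->].
Qed.

(** Excedances and anti-excedances are matched separately. In both cases the height is the number of
    open arcs, and its positivity is the matching condition. *)
Lemma type_realizable (T : 'I_n -> step) (k : nat -> nat) :
    k 0%N = 0%N -> k n = 0%N ->
    (forall i, k i.+1 = next_height (k i) (T i)) ->
    (forall i, T i \notin [:: None; Some (true, false)] -> 0 < k i)%N ->
  exists s, forall i, type_of s i = T i.
Proof.
move=> k0 kn kS k_gt0.
(* [E] stands for excedances and [A] for anti-excedances; [pos] looks at an index as a position,
   [val] as a value. *)
pose posE (a : step) := if a is Some (b, _) then b else false.
pose posA (a : step) := if a is Some (b, _) then ~~ b else false.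
pose valE (a : step) := if a is Some (_, b) then b else false.
pose valA (a : step) := if a is Some (_, b) then ~~ b else false.
pose below (Z : step -> bool) m := #|[set j in [set j | Z (T j)] | (j < m)%N]|.
have below0 Z : below Z 0%N = 0%N by apply: eq_card0 => j; rewrite !inE andbF.
have belown Z : below Z n = #|[set j | Z (T j)]|.
  by apply: eq_card => j; rewrite !inE ltn_ord andbT.
have belowS Z i : below Z i.+1 = (Z (T i) + below Z i)%N.
  rewrite /below (cardsD1 i) !inE leqnn andbT; congr (_ + _)%N.
  apply: eq_card => j; rewrite !inE -val_eqE /=; case: (Z _); lia.
have countE m : (m <= n)%N -> below posE m = (below valE m + k m)%N
                          /\ below valA m = (below posA m + k m)%N.
  elim: m => [_|m IHm lt_mn]; first by rewrite !below0 k0.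
  have [] := IHm (ltnW lt_mn); rewrite !(belowS _ (Ordinal lt_mn)) (kS (Ordinal lt_mn)).
  have := k_gt0 (Ordinal lt_mn).
  by case: (T _) => [[[] []]|] /= => [/(_ isT)||/(_ isT)|/(_ isT)|]; lia.
have [cardE cardA] : #|[set j | posE (T j)]| = #|[set j | valE (T j)]|
                  /\ #|[set j | valA (T j)]| = #|[set j | posA (T j)]|.
  by have [] := countE n (leqnn n); rewrite !belown kn !addn0.
have belowSE Z i : #|[set j in [set j | Z (T j)] | (j <= i)%N]| = below Z i.+1 by [].
have [|f1 [g1 [f1P g1P]]] := ascending_matching cardE.
  move=> i; rewrite belowSE belowS.
  have [] := countE i (ltnW (ltn_ord i)); have := k_gt0 i; rewrite -/(below _ _).
  by case: (T i) => [[[] []]|] /= => [/(_ isT)||/(_ isT)|/(_ isT)|]; lia.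
have [|f2 [g2 [f2P g2P]]] := ascending_matching cardA.
  move=> i; rewrite belowSE belowS.
  have [] := countE i (ltnW (ltn_ord i)); have := k_gt0 i; rewrite -/(below _ _).
  by case: (T i) => [[[] []]|] /= => [/(_ isT)||/(_ isT)|/(_ isT)|]; lia.
(* The second matching goes up from values to positions, so anti-excedances take their image from
   its inverse [g2]. *)
pose h i := if posE (T i) then f1 i else if posA (T i) then g2 i else i.
pose h' i := if valE (T i) then g1 i else if valA (T i) then f2 i else i.
have f1P' i : posE (T i) -> [/\ valE (T (f1 i)), (i < f1 i)%N & g1 (f1 i) = i].
  by move=> Ti; have := f1P i; rewrite !inE; apply.
have g1P' i : valE (T i) -> [/\ posE (T (g1 i)), (g1 i < i)%N & f1 (g1 i) = i].
  by move=> Ti; have := g1P i; rewrite !inE; apply.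
have f2P' i : valA (T i) -> [/\ posA (T (f2 i)), (i < f2 i)%N & g2 (f2 i) = i].
  by move=> Ti; have := f2P i; rewrite !inE; apply.
have g2P' i : posA (T i) -> [/\ valA (T (g2 i)), (g2 i < i)%N & f2 (g2 i) = i].
  by move=> Ti; have := g2P i; rewrite !inE; apply.
have hK : cancel h h'.
  move=> i; rewrite /h; case: ifP => [/f1P'[+ _ e]|nE]; first by rewrite /h' e => ->.
  case: ifP => [/g2P'[+ _ e]|nA].
    by rewrite /h' e; case: (T (g2 i)) => [[a []]|].
  by rewrite /h'; move: nE nA; case: (T i) => [[[] b]|].
pose s := perm (can_inj hK).
have sV i : (s^-1)%g i = h' i.
  by have := hK ((s^-1)%g i); rewrite -[h _](permE (can_inj hK)) permKV.
exists s => i; apply: type_ofP; rewrite sV permE /h /h'.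
have := f1P' i; have := g1P' i; have := f2P' i; have := g2P' i.
case: (T i) => [[[] []]|] //= pA vA vE pE; split; by [case: pE|case: pA|case: vE|case: vA].
Qed.

End Types.

(** * Permutations with a given type word *)

Section SameType.

Variable n : nat.
Implicit Types (s t : 'S_n) (i j v : 'I_n).

Definition same_type s t := [forall i, type_of t i == type_of s i].

Lemma same_typeP s t : reflect (forall i, type_of t i = type_of s i) (same_type s t).
Proof. exact: eqfunP. Qed.

Lemma same_type_height s t m : same_type s t -> (m <= n)%N -> height t m = height s m.
Proof.
move=> /same_typeP eq_ty; elim: m => [|m IHm] lt_mn; first by rewrite !height0.
by rewrite !(heightS _ (Ordinal lt_mn)) /= IHm ?eq_ty // ltnW.
Qed.

Lemma same_type_exc s t i : same_type s t -> (i < t i)%N = (i < s i)%N.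
Proof.
move/same_typeP/(_ i); have := type_cases s i; have := type_cases t i => + + eq_ty.
rewrite eq_ty; case: (type_of s i) => [[[] b] [lt_t _] [lt_s _]|[-> _] [-> _]//].
  by rewrite lt_t lt_s.
by rewrite !ltnNge !(ltnW lt_t, ltnW lt_s).
Qed.

Lemma same_type_value_exc s t i :
  same_type s t -> ((t^-1)%g i < i)%N = ((s^-1)%g i < i)%N.
Proof.
move/same_typeP/(_ i); have := type_cases s i; have := type_cases t i => + + eq_ty.
rewrite eq_ty; case: (type_of s i) => [[a []] [_ lt_t] [_ lt_s]|[_ ->] [_ ->]//].
  by rewrite lt_t lt_s.
by rewrite !ltnNge !(ltnW lt_t, ltnW lt_s).
Qed.

Lemma type_of_ext s t i :
    (i < t i)%N = (i < s i)%N -> (t i < i)%N = (s i < i)%N ->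
    ((t^-1)%g i < i)%N = ((s^-1)%g i < i)%N ->
  type_of t i = type_of s i.
Proof.
move=> gtE ltE ltVE; rewrite /type_of gtE ltVE.
suff -> : (t i == i) = (s i == i) by [].
have eqE u : (u == i) = ~~ (i < u)%N && ~~ (u < i)%N.
  by rewrite -val_eqE /=; case: ltngtP.
by rewrite !eqE gtE ltE.
Qed.

(** Both values lie on the same side of both positions, so the exchange changes no comparison
    between a position and its value. *)
Lemma tperm_same_type s i j :
    [&& i < s i, j < s j, i < s j & j < s i]%N ||
      [&& s i < i, s j < j, s j < i & s i < j]%N ->
  same_type s (tperm i j * s)%g.
Proof.
move=> lts; apply/same_typeP => k.
have tE l : (tperm i j * s)%g l = s (tperm i j l) by rewrite permM.
have tVE : ((tperm i j * s)^-1)%g k = tperm i j ((s^-1)%g k).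
  by rewrite invMg permM tpermV.
case/orP: lts => /and4P[lt1 lt2 lt3 lt4]; apply: type_of_ext; rewrite ?tE ?tVE.
- by case: tpermP => [->|->|//]; rewrite ?lt1 ?lt2 ?lt3 ?lt4.
- by case: tpermP => [->|->|//]; rewrite !ltnNge !(ltnW lt1, ltnW lt2, ltnW lt3, ltnW lt4).
- case: tpermP => [e|e|//]; rewrite e -[k](permKV s) e ?lt1 ?lt2 ?lt3 ?lt4 //.
- by case: tpermP => [->|->|//]; rewrite !ltnNge !(ltnW lt1, ltnW lt2, ltnW lt3, ltnW lt4).
- by case: tpermP => [->|->|//]; rewrite ?lt1 ?lt2 ?lt3 ?lt4.
- case: tpermP => [e|e|//]; rewrite e -[k](permKV s) e.
    by rewrite !ltnNge !(ltnW lt1, ltnW lt2, ltnW lt3, ltnW lt4).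
  by rewrite !ltnNge !(ltnW lt1, ltnW lt2, ltnW lt3, ltnW lt4).
Qed.

(** Positions that are not excedances come first, in increasing order; then the
    excedances follow, in decreasing order. *)
Definition choice_key s i : nat := if (i < s i)%N then (n + n - i)%N else i.

Lemma choice_key_inj s : injective (choice_key s).
Proof.
move=> i j eq_key; apply/val_inj; move: eq_key; rewrite /choice_key /=.
by have := ltn_ord i; have := ltn_ord j; case: ifP; case: ifP; lia.
Qed.

Lemma agree_below_antiexc s t i j :
    agree_below (choice_key s) (choice_key s i) s t -> ~~ (i < s i)%N ->
  ~~ (j < s j)%N -> (j < i)%N -> t j = s j.
Proof.
move=> /forallP/(_ j) + nexc_i nexc_j lt_ji.
by rewrite /choice_key !ifN // lt_ji => /eqP.
Qed.

Lemma agree_below_exc s t i j :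
    agree_below (choice_key s) (choice_key s i) s t -> (i < s i)%N ->
  (i < j)%N -> t j = s j.
Proof.
move=> /forallP/(_ j) + exc_i lt_ij; rewrite /choice_key exc_i => /implyP agr.
by apply/eqP/agr; have := ltn_ord i; have := ltn_ord j; case: ifP; lia.
Qed.

(** The position [j] is an anti-excedance treated no earlier than [i], so exchanging the two values
    keeps all previous choices. *)
Lemma swap_antiexc s i j : (s i < i)%N -> (s j < i <= j)%N ->
  exists t, [/\ same_type s t, agree_below (choice_key s) (choice_key s i) s t
              & t i = s j].
Proof.
move=> lt_i /andP[lt_ji le_ij]; exists (tperm i j * s)%g; split.
- apply: tperm_same_type; apply/orP; right; apply/and4P; split=> //; lia.
- apply/forallP => l; apply/implyP; rewrite /choice_key permM.
  case: tpermP => [->|->|//]; first by case: ifP; lia.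
  by have := ltn_ord i; have := ltn_ord j; do 2 case: ifP; lia.
- by rewrite permM tpermL.
Qed.

Lemma swap_exc s i j : (i < s i)%N -> (j <= i < s j)%N ->
  exists t, [/\ same_type s t, agree_below (choice_key s) (choice_key s i) s t
              & t i = s j].
Proof.
move=> gt_i /andP[le_ji lt_ij]; exists (tperm i j * s)%g; split.
- apply: tperm_same_type; apply/orP; left; apply/and4P; split=> //; lia.
- apply/forallP => l; apply/implyP; rewrite /choice_key permM.
  case: tpermP => [->|->|//]; first by case: ifP; lia.
  by have := ltn_ord i; have := ltn_ord j; do 2 case: ifP; lia.
- by rewrite permM tpermL.
Qed.

(** These are the values available to [i] in the first phase; [values_above] plays that role in the
    second. *)
Definition values_across s i := [set v : 'I_n | (v < i <= (s^-1)%g v)%N].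
Definition values_above s i := [set v : 'I_n | ((s^-1)%g v <= i < v)%N].

(** Suppose [t] used such a value before [i]. Either it is an excedance value for [t], hence for
    [s], or it sits at a position where [s] and [t] agree; both contradict its position in [s]. *)
Lemma values_across_sub s t i :
    same_type s t ->
    (forall j, ~~ (j < s j)%N -> (j < i)%N -> t j = s j) ->
  values_across s i \subset values_across t i.
Proof.
move=> st agr; apply/subsetP => v; rewrite !inE => /andP[lt_vi le_i].
rewrite lt_vi leqNgt; apply/negP => lt_i.
have [exc|nexc] := boolP ((t^-1)%g v < v)%N.
  by move: exc; rewrite (same_type_value_exc _ st) ltnNge (leq_trans (ltnW lt_vi)).
have /agr/(_ lt_i) : ~~ ((t^-1)%g v < s ((t^-1)%g v))%N.
  by rewrite -(same_type_exc _ st) permKV.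
by rewrite permKV => e; move: le_i; rewrite e permK leqNgt lt_i.
Qed.

Lemma same_type_sym s t : same_type s t -> same_type t s.
Proof. by move/same_typeP => st; apply/same_typeP => i; rewrite st. Qed.

Lemma values_across_agree s t i :
    same_type s t ->
    (forall j, ~~ (j < s j)%N -> (j < i)%N -> t j = s j) ->
  values_across t i = values_across s i.
Proof.
move=> st agr; apply/eqP; rewrite eqEsubset !values_across_sub //.
  exact: same_type_sym.
by move=> j nexc lt_ji; rewrite agr // -(same_type_exc _ st).
Qed.

Lemma inv_agree s t i v :
    (forall j, (i < j)%N -> t j = s j) -> (i < (s^-1)%g v)%N ->
  (t^-1)%g v = (s^-1)%g v.
Proof. by move=> agr /agr; rewrite permKV => {1}<-; rewrite permK. Qed.

Lemma values_above_agree s t i :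
  (forall j, (i < j)%N -> t j = s j) -> values_above t i = values_above s i.
Proof.
move=> agr; apply/setP => v; rewrite !inE; congr (_ && _).
rewrite leqNgt [in RHS]leqNgt; congr (~~ _); apply/idP/idP => lt_i.
  rewrite (@inv_agree t s i v) //.
  by move=> j /agr.
by rewrite (@inv_agree s t i v).
Qed.

(** Later values that are at least [i] exceed [s i] anyway, and the later ones below [i] all belong
    to [values_across s i]. *)
Lemma antirecord_min s i v0 :
    (s i < i)%N -> v0 \in values_across s i ->
    (forall v, v \in values_across s i -> v0 <= v)%N ->
  antirecord s i = (s i == v0).
Proof.
move=> lt_i; rewrite inE => /andP[lt_v0 le_i] min_v0; apply/forallP/eqP => [arec|e j].
  have Vsi : s i \in values_across s i by rewrite inE permK leqnn lt_i.
  have := arec ((s^-1)%g v0); rewrite permKV [(s i < _)%N]ltnNge min_v0 //.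
  rewrite implybF -leqNgt => le_i'.
  have -> : i = (s^-1)%g v0 by apply/val_inj/eqP; rewrite eqn_leq le_i.
  exact: permKV.
apply/implyP => lt_ij; have [lt_sj|] := ltnP (s j) i; last exact: leq_trans.
rewrite ltn_neqAle (inj_eq val_inj) (inj_eq perm_inj) e min_v0.
  by rewrite -val_eqE /= ltn_eqF.
by rewrite inE permK lt_sj ltnW.
Qed.

Lemma record_max s i v0 :
    (i < s i)%N -> v0 \in values_above s i ->
    (forall v, v \in values_above s i -> v <= v0)%N ->
  record s i = (s i == v0).
Proof.
move=> gt_i; rewrite inE => /andP[le_i lt_v0] max_v0; apply/forallP/eqP => [rec|e j].
  have Vsi : s i \in values_above s i by rewrite inE permK leqnn gt_i.
  have := rec ((s^-1)%g v0); rewrite permKV [(_ < s i)%N]ltnNge max_v0 //.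
  rewrite implybF -leqNgt => le_i'.
  have -> : i = (s^-1)%g v0 by apply/val_inj/eqP; rewrite eqn_leq le_i'.
  exact: permKV.
apply/implyP => lt_ji; have [le_sj|lt_sj] := leqP (s j) i.
  exact: leq_ltn_trans gt_i.
rewrite ltn_neqAle (inj_eq val_inj) (inj_eq perm_inj) e max_v0.
  by rewrite -val_eqE /= ltn_eqF.
by rewrite inE permK lt_sj ltnW.
Qed.

Lemma cycle_min_ge s i : cycle_min s i -> (i <= s i)%N && (i <= (s^-1)%g i)%N.
Proof.
move=> /forall_inP min_i; rewrite !min_i //; last exact: (mem_porbit s 1 i).
by rewrite -porbitV; apply: (mem_porbit _ 1 i).
Qed.

(* [v0] is the first element on the backward orbit of [i] whose own preimage
   is at most [i]; that stretch of the orbit is common to all the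
   permutations [t] considered. *)
Lemma cycle_min_choice s i : (i < (s^-1)%g i)%N ->
  exists2 v0, v0 \in values_above s i &
    forall t, (forall j, (i < j)%N -> t j = s j) ->
      cycle_min t i = (t i == v0).
Proof.
move=> gt_Vi.
(* The backward orbit eventually returns to [i] itself. *)
have ex_r : exists r, (iter r.+1 (s^-1)%g i <= i)%N.
  exists #|porbit (s^-1)%g i|.-1; rewrite prednK ?iter_porbit //.
  by rewrite lt0n card_porbit_neq0.
have [r0 le_r0 min_r0] := ex_minnP ex_r.
have gt_r r : (0 < r <= r0)%N -> (i < iter r (s^-1)%g i)%N.
  case: r => // r /andP[_ lt_r]; rewrite ltnNge; apply/negP => /min_r0; lia.
have r0_gt0 : (0 < r0)%N by case: (r0) le_r0 => //=; rewrite leqNgt gt_Vi.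
exists (iter r0 (s^-1)%g i); first by rewrite inE le_r0 gt_r ?r0_gt0 /=.
move=> t agr.
have tE r : (r <= r0)%N -> iter r (t^-1)%g i = iter r (s^-1)%g i.
  elim: r => [//|r IHr] lt_r; rewrite !iterS IHr 1?ltnW //.
  by apply: (inv_agree agr); apply: (gt_r r.+1).
apply/idP/eqP => [/forall_inP min_i|ti]; last first.
  apply: (cycle_min_return (t := r0)) => [|[|r] le_r]; rewrite ?tE //.
  by rewrite ltnW // gt_r.
(* The preimage of [v0] under [t] is at most [i] because [v0] is still available, and at least [i]
   by minimality. *)
suff e : (t^-1)%g (iter r0 (s^-1)%g i) = i by rewrite -[in LHS]e permKV.
apply/val_inj/eqP; rewrite eqn_leq; apply/andP; split.
  have : iter r0 (s^-1)%g i \in values_above t i.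
    by rewrite (values_above_agree agr) inE le_r0 gt_r ?r0_gt0 /=.
  by rewrite inE => /andP[].
by rewrite -tE //; apply: min_i; rewrite -porbitV -iterS -permX mem_porbit.
Qed.

End SameType.

(** * Weights *)

Section Weights.

Variables (R : comNzRingType) (x1 x2 y1 y2 u1 u2 v2 lambda : R) (w : nat -> R).

(** The value is [0] for the steps that cannot occur at height [0]. *)
Definition step_weight (k : nat) (a : step) : R :=
  match a, k with
  | None, _ => lambda * w k
  | Some (true, false), _ => y1 * (lambda + k%:R)
  | _, 0 => 0
  | Some (false, true), m.+1 => x1 + m%:R * u1
  | Some (true, true), m.+1 => y2 + m%:R * v2
  | Some (false, false), m.+1 => x2 + m%:R * u2
  end.

(** Each cycle puts its [lambda] on its minimum, so that the weight becomes a product over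
    indices. *)
Definition index_weight n (s : 'S_n) (i : 'I_n) : R :=
  match type_of s i with
  | None => w (psnest s i)
  | Some (true, false) => y1
  | Some (true, true) => if record s i then y2 else v2
  | Some (false, true) => if antirecord s i then x1 else u1
  | Some (false, false) => if antirecord s i then x2 else u2
  end * (if cycle_min s i then lambda else 1).

Lemma card_ord_lt n k : (k <= n)%N -> #|[set j : 'I_n | (j < k)%N]| = k.
Proof.
by move=> le_kn; rewrite -sum1dep_card (big_ord_narrow le_kn) sum1_card card_ord.
Qed.

(** By pigeonhole: [s] injects the positions below [i] into the values below [s i]. *)
Lemma record_ge n (s : 'S_n) i : record s i -> (i <= s i)%N.
Proof.
move=> /forallP rec; rewrite -[X in (X <= _)%N](card_ord_lt (ltnW (ltn_ord i))).
rewrite -(card_imset _ (@perm_inj _ s)).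
rewrite -[X in (_ <= X)%N](card_ord_lt (ltnW (ltn_ord (s i)))).
apply: subset_leq_card; apply/subsetP => _ /imsetP[j + ->]; rewrite !inE.
exact: implyP.
Qed.

Lemma antirecord_le n (s : 'S_n) i : antirecord s i -> (s i <= i)%N.
Proof.
move=> /forallP arec; rewrite -ltnS -[X in (X <= _)%N](card_ord_lt (ltn_ord (s i))).
rewrite -(card_imset _ (@perm_inj _ (s^-1)%g)).
rewrite -[X in (_ <= X)%N](card_ord_lt (ltn_ord i)).
apply: subset_leq_card; apply/subsetP => _ /imsetP[v + ->]; rewrite !inE !ltnS.
by have := arec ((s^-1)%g v); rewrite permKV; case: leqP => //= _; rewrite ltnNge => /negPf->.
Qed.

Lemma expr_card (n : nat) (P : pred 'I_n) (x : R) :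
  x ^+ #|[set i | P i]| = \prod_i (if P i then x else 1).
Proof. by rewrite cardsE -big_mkcond prodr_const. Qed.

(** An excedance is never an antirecord and an anti-excedance never a record, so one test per index
    separates exclusive from neither. *)
Lemma Qhat_index_weight n :
  Qhat x1 x2 y1 y2 u1 u2 y1 v2 w lambda n =
  \sum_(s : 'S_n) \prod_i index_weight s i.
Proof.
apply: eq_bigr => s _; rewrite card_cycle_min /eareccpeak /eareccdfall /ereccval.
rewrite /ereccdrise /nrcpeak /nrcdfall /nrcval /nrcdrise !expr_card.
rewrite [\prod_(i | s i == i) _]big_mkcond -!big_split /=.
apply: eq_bigr => i _; rewrite /index_weight; congr (_ * _).
have := type_cases s i; rewrite /earec /erec /nrar /cpeak /cval /cdrise /cdfall.
have := @record_ge n s i; have := @antirecord_le n s i.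
case: (type_of s i) => [[[] []] arec rec []|_ _ [-> ->]].
- move=> lt_i lt_Vi.
  rewrite lt_i lt_Vi !ltnNge !(ltnW lt_i, ltnW lt_Vi) /= -val_eqE (gtn_eqF lt_i).
  have -> : antirecord s i = false by apply/negP => /arec; rewrite leqNgt lt_i.
  by case: (record s i); rewrite /= ?mul1r ?mulr1.
- move=> lt_i lt_Vi.
  rewrite lt_i lt_Vi !ltnNge !(ltnW lt_i, ltnW lt_Vi) /= -val_eqE (gtn_eqF lt_i).
  have -> : antirecord s i = false by apply/negP => /arec; rewrite leqNgt lt_i.
  by case: (record s i); rewrite /= ?mul1r ?mulr1.
- move=> lt_i lt_Vi.
  rewrite lt_i lt_Vi !ltnNge !(ltnW lt_i, ltnW lt_Vi) /= -val_eqE (ltn_eqF lt_i).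
  have -> : record s i = false by apply/negP => /rec; rewrite leqNgt lt_i.
  by case: (antirecord s i); rewrite /= ?mul1r ?mulr1.
- move=> lt_i lt_Vi.
  rewrite lt_i lt_Vi !ltnNge !(ltnW lt_i, ltnW lt_Vi) /= -val_eqE (ltn_eqF lt_i).
  have -> : record s i = false by apply/negP => /rec; rewrite leqNgt lt_i.
  by case: (antirecord s i); rewrite /= ?mul1r ?mulr1.
by rewrite ltnn eqxx /= !mul1r.
Qed.

Lemma sum_marked n (V : {set 'I_n}) v0 (a b : R) : v0 \in V ->
  \sum_(v in V) (if v == v0 then a else b) = a + (#|V|.-1)%:R * b.
Proof.
move=> Vv0; rewrite (bigD1 v0) //= eqxx; congr (_ + _).
rewrite (eq_bigr (fun=> b)) => [|v /andP[_ /negPf-> //]].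
rewrite sumr_const mulr_natl; congr (_ *+ _).
by rewrite (cardD1 v0 V) Vv0; apply: eq_card => v; rewrite !inE andbC.
Qed.

(** * The sum over a type class *)

Section OneType.

Variables (n : nat) (s0 : 'S_n).

Let X := [set s | same_type s0 s].

Lemma choice_key_type s i : s \in X -> choice_key s i = choice_key s0 i.
Proof. by rewrite inE /choice_key => /same_type_exc ->. Qed.

Lemma agree_below_type s i t : s \in X ->
  agree_below (choice_key s) (choice_key s i) s t =
  agree_below (choice_key s0) (choice_key s0 i) s t.
Proof. by move=> sX; apply: eq_forallb => j; rewrite !choice_key_type. Qed.

Lemma same_type_trans s t : s \in X -> same_type s t -> t \in X.
Proof.
rewrite !inE => /same_typeP ss0 /same_typeP st; apply/same_typeP => i.
by rewrite st ss0.
Qed.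

Lemma same_type_in s t : s \in X -> t \in X -> same_type s t.
Proof.
rewrite !inE => /same_typeP ss0 /same_typeP ts0; apply/same_typeP => i.
by rewrite ts0 ss0.
Qed.

Definition type_weight (i : 'I_n) := step_weight (height s0 i) (type_of s0 i).

(** Common pattern for indices that are not fixed: one marked value has weight [a], all others
    [b]. *)
Lemma choice_at_marked s (i : 'I_n) (V : {set 'I_n}) v0 (a b : R) :
    v0 \in V ->
    (forall t, t \in X -> agree_below (choice_key s0) (choice_key s0 i) s t ->
       t i \in V /\ index_weight t i = if t i == v0 then a else b) ->
    (forall v, v \in V -> exists t, [/\ same_type s t,
        agree_below (choice_key s) (choice_key s i) s t & t i = v]) ->
    s \in X -> a + (#|V|.-1)%:R * b = type_weight i ->
  choice_at X (choice_key s0) (fun i t => index_weight t i) type_weight i s V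
    (fun v => if v == v0 then a else b).
Proof.
move=> Vv0 inV extV sX sumV; split=> // [v Vv|]; last by rewrite sum_marked.
have [t [st agr tv]] := extV v Vv; exists t; first exact: same_type_trans st.
by rewrite -agree_below_type.
Qed.

Lemma choice_exists (i : 'I_n) s : s \in X ->
  exists V, exists g,
    choice_at X (choice_key s0) (fun i t => index_weight t i) type_weight i s V g.
Proof.
move=> sX; have s0s : same_type s0 s by move: sX; rewrite inE.
have ty_s : type_of s i = type_of s0 i by exact/same_typeP.
have hE m : (m <= n)%N -> height s m = height s0 m by exact: same_type_height.
have agrE t : t \in X -> agree_below (choice_key s0) (choice_key s0 i) s t ->
    agree_below (choice_key s) (choice_key s i) s t.
  by rewrite agree_below_type.
have ty_t t : t \in X -> type_of t i = type_of s0 i.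
  by rewrite inE => /same_typeP.
rewrite /type_weight; have := type_cases s i; rewrite ty_s.
case ty_i: (type_of s0 i) => [[[] b]|] [Hs HVs].
- have cV : #|values_above s i| = height s0 i.+1.
    by rewrite -hE // -card_values_above.
  have Vsi : s i \in values_above s i by rewrite inE permK leqnn Hs.
  have extV v : v \in values_above s i -> exists t, [/\ same_type s t,
        agree_below (choice_key s) (choice_key s i) s t & t i = v].
    rewrite inE => Vv; have [|t [st agr tv]] := @swap_exc _ s i ((s^-1)%g v) Hs.
      by rewrite permKV.
    by exists t; rewrite tv permKV.
  have agr_gt t : t \in X -> agree_below (choice_key s0) (choice_key s0 i) s t ->
      forall j : 'I_n, (i < j)%N -> t j = s j.
    by move=> tX agr j; apply: agree_below_exc Hs; apply: agrE.
  have t_gt t : t \in X -> (i < t i)%N.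
    by move=> tX; rewrite (same_type_exc _ (same_type_in sX tX)).
  have inV t : t \in X -> agree_below (choice_key s0) (choice_key s0 i) s t ->
      t i \in values_above s i.
    move=> tX agr; rewrite -(values_above_agree (agr_gt t tX agr)) inE.
    by rewrite permK leqnn t_gt.
  case: b ty_i HVs => ty_i HVs.
    (* Cycle double rise: the marked value is the largest, which makes [i] a record. *)
    have [v0 /= Vv0 max_v0] :=
      @arg_maxnP _ (s i) (mem (values_above s i)) (fun j : 'I_n => val j) Vsi.
    exists (values_above s i), (fun v => if v == v0 then y2 else v2).
    apply: choice_at_marked => // [t tX agr|].
      split; first exact: inV.
      rewrite /index_weight ty_t // ty_i.
      have -> : cycle_min t i = false.
        apply/negP => /cycle_min_ge/andP[_]; rewrite leqNgt.
        by rewrite (same_type_value_exc _ (same_type_in sX tX)) HVs.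
      rewrite mulr1 (@record_max _ t i v0) ?t_gt //;
        by rewrite (values_above_agree (agr_gt t tX agr)).
    rewrite /type_weight ty_i cV heightS ty_i /=.
    move: cV; rewrite heightS ty_i /= (cardD1 (s i)) Vsi.
    by case: (height s0 i).
  (* Cycle valley: the marked value closes the cycle. The height goes up by one here, so the
     unmarked values are as many as the height before [i]. *)
  have [v0 Vv0 v0P] := cycle_min_choice HVs.
  exists (values_above s i), (fun v => if v == v0 then y1 * lambda else y1 * 1).
  apply: choice_at_marked => // [t tX agr|].
    split; first exact: inV.
    rewrite /index_weight ty_t // ty_i v0P; last exact: agr_gt.
    by case: ifP.
  by rewrite /type_weight ty_i cV heightS ty_i /=; ring.
- have cV : #|values_across s i| = height s0 i.
    by rewrite -hE ?card_values_across // ltnW.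
  have Vsi : s i \in values_across s i by rewrite inE permK leqnn Hs.
  have nexc : ~~ (i < s i)%N by rewrite -leqNgt ltnW.
  have extV v : v \in values_across s i -> exists t, [/\ same_type s t,
        agree_below (choice_key s) (choice_key s i) s t & t i = v].
    rewrite inE => Vv; have [|t [st agr tv]] := @swap_antiexc _ s i ((s^-1)%g v) Hs.
      by rewrite permKV.
    by exists t; rewrite tv permKV.
  have t_lt t : t \in X -> (t i < i)%N.
    by move=> tX; have := type_cases t i; rewrite ty_t // ty_i => -[].
  have V_t t : t \in X -> agree_below (choice_key s0) (choice_key s0 i) s t ->
      values_across t i = values_across s i.
    move=> tX agr; apply: values_across_agree (same_type_in sX tX) _ => j nexc_j lt_ji.
    exact: agree_below_antiexc (agrE t tX agr) nexc nexc_j lt_ji.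
  have [v0 /= Vv0 min_v0] :=
    @arg_minnP _ (s i) (mem (values_across s i)) (fun j : 'I_n => val j) Vsi.
  have markE t : t \in X -> agree_below (choice_key s0) (choice_key s0 i) s t ->
      [/\ t i \in values_across s i, antirecord t i = (t i == v0)
        & cycle_min t i = false].
    move=> tX agr; split.
    - by rewrite -(V_t t tX agr) inE permK leqnn t_lt.
    - by apply: antirecord_min; rewrite ?t_lt ?(V_t t tX agr).
    - by apply/negP => /cycle_min_ge/andP[+ _]; rewrite leqNgt t_lt.
  (* This excludes the default value [0] of [step_weight]. *)
  have h_gt0 : (0 < height s0 i)%N by rewrite -cV; apply/card_gt0P; exists (s i).
  case: b ty_i {HVs} => ty_i.
    exists (values_across s i), (fun v => if v == v0 then x1 else u1).
    apply: choice_at_marked => // [t tX agr|].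
      have [Vti arec cmin] := markE t tX agr.
      by rewrite /index_weight ty_t // ty_i arec cmin mulr1.
    by rewrite /type_weight ty_i cV; case: (height s0 i) h_gt0.
  exists (values_across s i), (fun v => if v == v0 then x2 else u2).
  apply: choice_at_marked => // [t tX agr|].
    have [Vti arec cmin] := markE t tX agr.
    by rewrite /index_weight ty_t // ty_i arec cmin mulr1.
  by rewrite /type_weight ty_i cV; case: (height s0 i) h_gt0.
(* A fixed point has a single choice and is a cycle by itself. *)
have fix_t t : t \in X -> t i = i.
  by move=> tX; have := type_cases t i; rewrite ty_t // ty_i => -[].
exists [set i], (fun=> lambda * w (height s0 i)); split=> [t tX _|v|].
- rewrite fix_t // set11; split=> //; rewrite /index_weight ty_t // ty_i.
  rewrite card_psnest ?fix_t // mulrC (same_type_height (s := s0)).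
  + rewrite ifT //; apply/forall_inP => j /porbitP[m ->].
    by rewrite permX iter_fix ?fix_t.
  + by move: tX; rewrite inE.
  + exact: ltnW.
- rewrite inE => /eqP ->; exists s => //; split=> //.
  by apply/forallP => j; rewrite eqxx implybT.
by rewrite big_set1 /type_weight ty_i.
Qed.

Lemma sum_same_type :
  \sum_(s | same_type s0 s) \prod_i index_weight s i = \prod_i type_weight i.
Proof.
rewrite -(sequential_choice (@choice_key_inj _ s0) choice_exists (s := s0)).
  by apply: eq_bigl => s; rewrite inE.
by rewrite inE; apply/same_typeP.
Qed.

End OneType.

(** * Summation over type words *)

Lemma sum_step (F : step -> R) :
  \sum_a F a = F None + F (Some (true, true)) + F (Some (true, false))
             + F (Some (false, true)) + F (Some (false, false)).
Proof.
rewrite (bigD1 None) //= (bigD1 (Some (true, true))) //=.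
rewrite (bigD1 (Some (true, false))) //= (bigD1 (Some (false, true))) //=.
rewrite (bigD1 (Some (false, false))) //= big1 ?addr0 ?addrA // => a.
by case: a => [[[] []]|].
Qed.

(** The final factor discards words that do not end at height [0]. *)
Fixpoint word_weight (k : nat) (T : seq step) : R :=
  if T is a :: T' then step_weight k a * word_weight (next_height k a) T'
  else (k == 0%N)%:R.

Definition up_weight k : R := y1 * (lambda + k%:R).
Definition level_weight k : R :=
  lambda * w k + (if k is m.+1 then x2 + m%:R * u2 + (y2 + m%:R * v2) else 0).
Definition down_weight k : R := if k is m.+1 then x1 + m%:R * u1 else 0.

Lemma sum_word_weight n k :
  \sum_(T : n.-tuple step) word_weight k T =
  motzkin up_weight level_weight down_weight 0 n k.
Proof.
elim: n k => [|n IHn] k.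
  rewrite (big_pred1 [tuple]) // => T; exact/esym/eqP/tuple0.
rewrite (reindex (fun p : step * n.-tuple step => [tuple of p.1 :: p.2])) /=; last first.
  exists (fun T : n.+1.-tuple step => (thead T, [tuple of behead T])) => [[a T] _|T _].
    by congr (_, _); apply: val_inj.
  by rewrite [RHS]tuple_eta.
rewrite -(pair_bigA _ (fun a (T : n.-tuple step) =>
  step_weight k a * word_weight (next_height k a) T)) /=.
rewrite sum_step -!mulr_sumr !IHn /= /up_weight /level_weight /down_weight.
by case: k => [|k] /=; ring.
Qed.

Lemma word_weight_prod k (T : seq step) :
  word_weight k T = (foldl next_height k T == 0%N)%:R *
    \prod_(i < size T) step_weight (foldl next_height k (take i T)) (nth None T i).
Proof.
elim: T k => [|a T IHT] k /=; first by rewrite big_ord0 mulr1.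
by rewrite IHT big_ord_recl /= mulrCA.
Qed.

Definition type_word n (s : 'S_n) : n.-tuple step := [tuple type_of s i | i < n].

Lemma type_word_eq n (s t : 'S_n) : (type_word t == type_word s) = same_type s t.
Proof.
apply/eqP/same_typeP => [eq_w i|eq_ty].
  by have /(congr1 (fun T : n.-tuple step => tnth T i)) := eq_w; rewrite !tnth_mktuple.
by apply: eq_from_tnth => i; rewrite !tnth_mktuple.
Qed.

Lemma foldl_type_word n (s : 'S_n) m : (m <= n)%N ->
  foldl next_height 0%N (take m (type_word s)) = height s m.
Proof.
elim: m => [_|m IHm lt_mn]; first by rewrite take0 height0.
rewrite (take_nth None) ?size_tuple // -cats1 foldl_cat /= IHm 1?ltnW //.
rewrite (heightS s (Ordinal lt_mn)) -(tnth_mktuple (type_of s) (Ordinal lt_mn)).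
by rewrite (tnth_nth None).
Qed.

Lemma word_weight_type n (s : 'S_n) :
  word_weight 0 (type_word s) = \prod_i type_weight s i.
Proof.
rewrite word_weight_prod -[X in foldl _ _ X]take_size size_tuple.
rewrite foldl_type_word // heightn eqxx mul1r; apply: eq_bigr => i _.
by rewrite foldl_type_word 1?ltnW // -tnth_nth tnth_mktuple.
Qed.

(** By [type_realizable], such a word ends at a nonzero height or has at height [0] a step of weight
    [0]. *)
Lemma word_weight_unrealizable n (T : n.-tuple step) :
  (forall s : 'S_n, type_word s != T) -> word_weight 0 T = 0.
Proof.
move=> no_s; pose k m := foldl next_height 0%N (take m T).
have kS (i : 'I_n) : k i.+1 = next_height (k i) (tnth T i).
  rewrite /k (take_nth None) ?size_tuple // -cats1 foldl_cat /=.
  by rewrite -tnth_nth.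
rewrite word_weight_prod -[X in foldl _ _ X]take_size size_tuple.
have [kn|_] := eqVneq; last by rewrite mul0r.
have [/forallP k_gt0|] := boolP
    [forall i, (tnth T i \notin [:: None; Some (true, false)]) ==> (0 < k i)%N].
  have k0 : k 0%N = 0%N by rewrite /k take0.
  have [i|s sT] := type_realizable k0 kn kS; first exact: implyP (k_gt0 i).
  by case/negP: (no_s s); apply/eqP/eq_from_tnth => i; rewrite tnth_mktuple.
rewrite negb_forall => /existsP[i]; rewrite negb_imply -eqn0Ngt => /andP[Ti /eqP ki].
rewrite (bigD1 i) //= -/(k i) ki -tnth_nth.
by move: Ti; case: (tnth T i) => [[[] []]|] //= _; rewrite mul0r mulr0.
Qed.

Lemma Qhat_motzkin n :
  Qhat x1 x2 y1 y2 u1 u2 y1 v2 w lambda n =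
  motzkin up_weight level_weight down_weight 0 n 0.
Proof.
rewrite Qhat_index_weight -sum_word_weight.
rewrite (partition_big (@type_word n) xpredT) //=; apply: eq_bigr => T _.
have [s0 /eqP <-|no_s] := pickP (fun s : 'S_n => type_word s == T).
  rewrite word_weight_type -sum_same_type; apply: eq_bigl => s.
  by rewrite type_word_eq.
by rewrite big_pred0 // word_weight_unrealizable // => s; rewrite no_s.
Qed.

End Weights.

Theorem theorem3p1 (R : comNzRingType)
    (x1 x2 y1 y2 u1 u2 v2 lambda : R) (w : nat -> R)
    (gamma beta : nat -> R)
    (gamma0 : gamma 0%N = lambda * w 0%N)
    (gammaS : forall n : nat, (1 <= n)%N ->
       gamma n = (x2 + n.-1%:R * u2) + (y2 + n.-1%:R * v2) + lambda * w n)
    (betaS : forall n : nat, (1 <= n)%N ->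
       beta n = (lambda + n.-1%:R) * (x1 + n.-1%:R * u1) * y1) :
  is_J_fraction (Qhat x1 x2 y1 y2 u1 u2 y1 v2 w lambda) gamma beta.
Proof.
(* Convergents of depth at least [n] already have the right coefficient of [t^n]. *)
move=> n; exists n => d le_nd; rewrite Qhat_motzkin.
apply: J_convergent_motzkin le_nd => [[|k]|k].
- by rewrite gamma0 /level_weight addr0.
- by rewrite gammaS // addrC.
- by rewrite betaS //= /up_weight; ring.
Qed.
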